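(* Let $(V,\omega)$ and $(V,\omega')$ be two vertex operator algebra structures on the same underlying vertex algebra $V$, and let $g$ be an automorphism of both structures of finite order $T$. Then $(V,\omega)$ is $g$-regular if and only if $(V,\omega')$ is $g$-regular. That is, the $g$-regularity of a vertex operator algebra is independent of the choice of the conformal vector.
   Context: All vector spaces are over $\mathbb{C}$. A vertex algebra is a vector space $V$ with a linear map $Y(\cdot,x):V\to(\operatorname{End}V)[[x,x^{-1}]]$, $v\mapsto Y(v,x)=\sum_{n\in\mathbb{Z}}v_nx^{-n-1}$, and a vector $\mathbf{1}\in V$ such that for all $u,v\in V$: $Y(\mathbf{1},z)=\operatorname{id}_V$ and $u_n\mathbf{1}=\delta_{n,-1}u$ for $n\ge -1$; $u_nv=0$ for $n$ sufficiently large; and the Jacobi identity $$z_0^{-1}\delta\left(\tfrac{z_1-z_2}{z_0}\right)Y(u,z_1)Y(v,z_2)-z_0^{-1}\delta\left(\tfrac{z_2-z_1}{-z_0}\right)Y(v,z_2)Y(u,z_1)=z_2^{-1}\delta\left(\tfrac{z_1-z_0}{z_2}\right)Y(Y(u,z_0)v,z_2)$$ holds, where $\delta(z)=\sum_{k\in\mathbb{Z}}z^k$ and binomials are expanded in nonnegative powers of the second variable. Put $\mathcal{D}v=v_{-2}\mathbf{1}$. A conformal vector of $V$ is $\omega\in V$ such that, with $L(n)=\omega_{n+1}$: $[L(m),L(n)]=(m-n)L(m+n)+\frac{m^3-m}{12}\delta_{m+n,0}c_V$ for some $c_V\in\mathbb{C}$; $L(-1)=\mathcal{D}$; $L(0)$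 is semisimple, $V=\bigoplus_{n\in\mathbb{C}}V_n$ with $L(0)|_{V_n}=n\operatorname{id}$; and each $L(n)$, $n\ge1$, acts locally nilpotently. A vertex operator algebra $(V,\omega)$ is a vertex algebra with a conformal vector such that $V_n=0$ unless $n\in\mathbb{Z}$, $\dim V_n<\infty$ for all $n\in\mathbb{Z}$, and $V_n=0$ for $n$ sufficiently small. An automorphism of $(V,\omega)$ is a linear isomorphism $g$ with $g(\mathbf{1})=\mathbf{1}$, $g(Y(u,z)v)=Y(g(u),z)g(v)$ and $g(\omega)=\omega$. For $g$ of finite order $T$, $V=\bigoplus_{r=0}^{T-1}V^r$ with $V^r=\{v\in V\mid gv=e^{-2\pi\sqrt{-1}r/T}v\}$. A weak $g$-twisted $V$-module is a vector space $M$ with a linear map $Y_M(\cdot,z):V\to(\operatorname{End}M)[[z^{1/T},z^{-1/T}]]$, with $Y_M(u,z)=\sum_{n\in r/T+\mathbb{Z}}u_nz^{-n-1}$ for $u\in V^r$, $0\le r\le T-1$, such that: $Y_M(\mathbf{1},z)=\operatorname{id}_M$; for $u\in V^r$, $w\in M$, $u_{r/T+n}w=0$ for $n$ sufficiently large; and for $u\in V^r$, $v\in V$, $$z_0^{-1}\delta\left(\tfrac{z_1-z_2}{z_0}\right)Y_M(u,z_1)Y_M(v,z_2)-z_0^{-1}\delta\left(\tfrac{z_2-z_1}{-z_0}\right)Y_M(v,z_2)Y_M(u,z_1)=z_2^{-1}\left(\tfrac{z_1-z_0}{z_2}\right)^{-r/T}\delta\left(\tfrac{z_1-z_0}{z_2}\right)Y_M(Y(u,z_0)v,z_2).$$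 A (ordinary) $g$-twisted $(V,\omega)$-module is a weak $g$-twisted $V$-module $M$ such that $M=\bigoplus_{\lambda\in\mathbb{C}}M_\lambda$, where $M_\lambda=\{w\in M\mid L_M(0)w=\lambda w\}$ and $Y_M(\omega,z)=\sum_{n\in\mathbb{Z}}L_M(n)z^{-n-2}$, each $M_\lambda$ is finite-dimensional, and for each fixed $\lambda\in\mathbb{C}$, $M_{n/T+\lambda}=0$ for all sufficiently negative integers $n$. $(V,\omega)$ is $g$-regular if every weak $g$-twisted $V$-module is a direct sum of irreducible (ordinary) $g$-twisted $(V,\omega)$-modules. *)

(* Defs.v *)
From HB Require Import structures.
From mathcomp Require Import all_boot all_order all_algebra.
From mathcomp Require Import complex.
From mathcomp Require Import boolp classical_sets functions cardinality fsbigop.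
From mathcomp Require Import reals trigo.

Set Implicit Arguments.
Unset Strict Implicit.
Unset Printing Implicit Defensive.

Import Order.TTheory GRing.Theory Num.Theory.

Local Open Scope classical_set_scope.
Local Open Scope ring_scope.

Section LinearAlgebra.
Variables (K : fieldType) (W : lmodType K).

Definition eigenspace_of (f : W -> W) (a : K) : set W :=
  [set w | f w = a *: w].

Definition finite_dimensional (A : set W) : Prop :=
  exists (n : nat) (b : 'I_n -> W),
    A = [set w | exists c : 'I_n -> K, w = \sum_(i < n) c i *: b i].

(* The big sum is over the (finite) support of x. *)
Definition is_direct_sum (I : choiceType) (A : I -> set W) : Prop :=
  forall w : W, exists! x : I -> W,
    [/\ forall i, A i (x i),
        finite_set [set i | x i != 0]
      & w = \sum_(i \in [set: I]) x i].

Definition is_subspace (A : set W) : Prop :=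
  A 0 /\ (forall (a : K) (x y : W), A x -> A y -> A (a *: x + y)).

Definition locally_nilpotent (f : W -> W) : Prop :=
  forall w : W, exists k : nat, iter k f w = 0.

End LinearAlgebra.

(* (x - y)^q = \sum_(i >= 0) binexp q i x^(q - i) y^i, with
   binexp q i = (-1)^i q (q - 1) ... (q - i + 1) / i!. *)
Definition binexp (K : fieldType) (q : K) (i : nat) : K :=
  (-1) ^+ i * (\prod_(j < i) (q - j%:R)) / i`!%:R.

(* va_mode u n is the operator u_n, so Y(u, z) = \sum_n u_n z^(- n - 1).

   va_jacobi is the coefficient of z0^(- l - 1) z1^(- m - 1) z2^(- n - 1) in
   the Jacobi identity applied to w, using the expansions
     z0^-1 delta((z1 - z2) / z0)
       = \sum_(l, i) binexp l i z0^(- l - 1) z1^(l - i) z2^i,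
     z0^-1 delta((z2 - z1) / - z0)
       = \sum_(l, i) (-1)^l binexp l i z0^(- l - 1) z2^(l - i) z1^i,
     z2^-1 delta((z1 - z0) / z2)
       = \sum_(k, i) binexp k i z2^(- k - 1) z1^(k - i) z0^i,
   where matching the power of z1 in the last one forces k = i - m - 1.
   A big sum with infinite support would be 0 by convention; va_trunc makes
   all three supports finite. *)
Record vertexAlgebra (R : realType) := VertexAlgebra {
  va_sort :> lmodType R[i];
  va_mode : va_sort -> int -> {linear va_sort -> va_sort};
  va_one : va_sort;
  va_mode_linear : forall (n : int) (v : va_sort),
    linear (fun u => va_mode u n v);
  va_one_mode : forall (n : int) (v : va_sort),
    va_mode va_one n v = if n == -1 then v else 0;
  va_creation : forall (u : va_sort) (n : int), -1 <= n ->
    va_mode u n va_one = if n == -1 then u else 0;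
  va_trunc : forall u v : va_sort,
    exists N : int, forall n : int, N <= n -> va_mode u n v = 0;
  va_jacobi : forall (u v w : va_sort) (l m n : int),
    \sum_(i \in [set: nat])
        binexp l%:~R i *: va_mode u (m + l - i%:Z) (va_mode v (n + i%:Z) w)
    - \sum_(i \in [set: nat])
        ((-1) ^ l * binexp l%:~R i)
          *: va_mode v (n + l - i%:Z) (va_mode u (m + i%:Z) w)
    = \sum_(i \in [set: nat])
        binexp (i%:Z - m - 1)%:~R i
          *: va_mode (va_mode u (l + i%:Z) v) (m + n - i%:Z) w
}.

Section VertexOperatorAlgebra.
Variables (R : realType) (V : vertexAlgebra R).

Definition va_D (v : V) : V := va_mode v (-2) (va_one V).

Definition vir (omega : V) (n : int) : V -> V := va_mode omega (n + 1).

Definition is_conformal_vector (omega : V) : Prop :=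
  let L := vir omega in
  [/\ exists c : R[i], forall (m n : int) (v : V),
        L m (L n v) - L n (L m v)
        = (m - n)%:~R *: L (m + n) v
          + (if m + n == 0 then ((m ^+ 3 - m)%:~R / 12%:R * c) *: v else 0),
      forall v : V, L (-1) v = va_D v,
      is_direct_sum (eigenspace_of (L 0))
    & forall n : int, 1 <= n -> locally_nilpotent (L n)].

Definition is_voa (omega : V) : Prop :=
  let V_ := eigenspace_of (vir omega 0) in
  [/\ is_conformal_vector omega,
      forall a : R[i], (forall n : int, a <> n%:~R) -> V_ a = [set 0],
      forall n : int, finite_dimensional (V_ n%:~R)
    & exists N : int, forall n : int, n <= N -> V_ n%:~R = [set 0]].

Definition is_voa_automorphism (omega : V) (g : {linear V -> V}) : Prop :=
  [/\ bijective g,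
      g (va_one V) = va_one V,
      forall (u : V) (n : int) (v : V),
        g (va_mode u n v) = va_mode (g u) n (g v)
    & g omega = omega].

Definition has_order (g : V -> V) (T : nat) : Prop :=
  [/\ (0 < T)%N,
      iter T g =1 id
    & forall k : nat, (0 < k < T)%N -> ~ (iter k g =1 id)].

(* exp(- 2 pi sqrt(-1) r / T) *)
Definition unity_root (T r : nat) : R[i] :=
  let t : R := 2 * pi * r%:R / T%:R in
  Complex (cos (- t)) (sin (- t)).

Definition twist_sector (g : V -> V) (T r : nat) : set V :=
  eigenspace_of g (unity_root T r).

End VertexOperatorAlgebra.

(* tm_mode u n is u_n, so Y_M(u, z) = \sum_n u_n z^(- n - 1) with n rational;
   tm_support puts the exponents of Y_M(u, z) in - r/T + Z for u in V^r, hence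
   in (1/T)Z for every u when g has order T.

   tm_jacobi is the coefficient of z0^(- l - 1) z1^(- m - 1) z2^(- n - 1), with
   m = r/T + p, in the twisted Jacobi identity applied to w: it is as in
   va_jacobi, except that
     z2^-1 ((z1 - z0) / z2)^(- r/T) delta((z1 - z0) / z2)
       = \sum_(k, i) binexp (k - r/T) i
                     z2^(- (k - r/T) - 1) z1^(k - r/T - i) z0^i,
   where matching the power of z1 forces k - r/T = i - m - 1. *)
Record weakTwistedModule (R : realType) (V : vertexAlgebra R)
    (g : V -> V) (T : nat) := WeakTwistedModule {
  tm_sort :> lmodType R[i];
  tm_mode : V -> rat -> {linear tm_sort -> tm_sort};
  tm_mode_linear : forall (n : rat) (w : tm_sort),
    linear (fun u => tm_mode u n w);
  tm_support : forall (r : nat) (u : V) (n : rat) (w : tm_sort),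
    (r < T)%N -> twist_sector g T r u ->
    (forall p : int, n <> r%:R / T%:R + p%:~R) -> tm_mode u n w = 0;
  tm_one_mode : forall (n : rat) (w : tm_sort),
    tm_mode (va_one V) n w = if n == -1 then w else 0;
  tm_trunc : forall (r : nat) (u : V) (w : tm_sort),
    (r < T)%N -> twist_sector g T r u ->
    exists N : int, forall n : int, N <= n ->
      tm_mode u (r%:R / T%:R + n%:~R) w = 0;
  tm_jacobi : forall (r : nat) (u v : V) (w : tm_sort)
                     (l p : int) (n : rat),
    (r < T)%N -> twist_sector g T r u ->
    let m : rat := r%:R / T%:R + p%:~R in
    \sum_(i \in [set: nat])
        binexp l%:~R i *: tm_mode u (m + l%:~R - i%:R) (tm_mode v (n + i%:R) w)
    - \sum_(i \in [set: nat])
        ((-1) ^ l * binexp l%:~R i)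
          *: tm_mode v (n + l%:~R - i%:R) (tm_mode u (m + i%:R) w)
    = \sum_(i \in [set: nat])
        binexp (ratr (i%:R - m - 1)) i
          *: tm_mode (va_mode u (l + i%:Z) v) (m + n - i%:R) w
}.

Section TwistedModules.
Variables (R : realType) (V : vertexAlgebra R) (g : V -> V) (T : nat).
Implicit Types M N : weakTwistedModule g T.

Definition is_module_hom M N (f : M -> N) : Prop :=
  forall (u : V) (n : rat) (w : M), f (tm_mode M u n w) = tm_mode N u n (f w).

Definition is_submodule M (A : set M) : Prop :=
  is_subspace A /\
  (forall (u : V) (n : rat) (w : M), A w -> A (tm_mode M u n w)).

Definition is_irreducible M : Prop :=
  (exists w : M, w <> 0) /\
  (forall A : set M, is_submodule A -> A = [set 0] \/ A = [set: M]).

Definition tm_vir M (omega : V) (n : int) : M -> M :=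
  tm_mode M omega (n + 1)%:~R.

Definition is_ordinary (omega : V) M : Prop :=
  let M_ := eigenspace_of (tm_vir (M := M) omega 0) in
  [/\ is_direct_sum M_,
      forall a : R[i], finite_dimensional (M_ a)
    & forall a : R[i], exists N : int, forall n : int, n <= N ->
        M_ (n%:~R / T%:R + a) = [set 0]].

Definition is_regular (omega : V) : Prop :=
  forall M, exists (I : choiceType) (N : I -> weakTwistedModule g T)
                   (f : forall i, {linear N i -> M}),
    [/\ forall i, is_irreducible (N i) /\ is_ordinary omega (N i),
        forall i, injective (f i) /\ is_module_hom (f i)
      & is_direct_sum (fun i => range (f i))].

End TwistedModules.

(* Main.v *)
Require Import Defs.
From HB Require Import structures.
From mathcomp Require Import all_boot all_order all_algebra.
From mathcomp Require Import complex.
From mathcomp Require Import boolp classical_sets functions cardinality fsbigop.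
From mathcomp Require Import reals trigo.
From mathcomp Require Import finmap.
From mathcomp Require Import zify ring lra.

(** It suffices to show that, when V is g-regular for omega, an irreducible
    twisted module M that is ordinary for omega is also ordinary for omega':
    the decomposition of a weak module supplied by regularity then serves for
    both conformal vectors.

    The heart of the matter is a finiteness property of M that does not mention
    omega' (truncated_set_fd): if S is a set of vectors of M such that every
    v has a bound K with v_n w = 0 for all n >= K and all w in S at once, then
    S lies in a finite-dimensional subspace.  Indeed the families of vectors of
    M, indexed by S, that are truncated uniformly in this sense form a weak
    twisted module under the pointwise modes (power_module).  By regularity
    this module is a direct sum of ordinary modules, so the inclusion of S in
    M, which is one of its elements, is a finite sum of L(0)-eigenvectors.
    Evaluating at the points of S puts S inside a finite sum of
    L(0)-eigenspaces of M, and these are finite-dimensional.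

    Call v_n lowering if v is homogeneous for L'(0), of weight at most n, and
    has only components of L(0)-weight at most n.  Such a mode strictly lowers
    L'(0)-weights as well as all L(0)-weights in M.  Because the L(0)-weights of
    M are bounded below in each coset of (1/T)Z, long words of lowering modes
    kill any given vector (lowering_nilpotent_exists), so a nonzero vector can
    be moved by lowering modes to a nonzero singular vector, one that every
    lowering mode kills.  The singular vectors are uniformly truncated, hence
    form a finite-dimensional space, and L'(0) preserves it because it
    commutes with a homogeneous mode up to a multiple of that mode.

    Everything follows from this.  L'(0) has an eigenvector among the singular
    vectors; the sum of its eigenspaces is a submodule, hence all of M.  The
    real part of an L'(0)-weight of M is at least the least one among singular
    vectors, which are finitely many weights.  Finally a fixed L'(0)-eigenspace
    is uniformly truncated, as otherwise modes would reach weights below this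
    bound, so it is finite-dimensional by the finiteness property again. *)

Set Implicit Arguments.
Unset Strict Implicit.
Unset Printing Implicit Defensive.

Import Order.TTheory GRing.Theory Num.Theory.

Local Open Scope classical_set_scope.
Local Open Scope ring_scope.

(** * Finite sums of eigenvectors *)

(** For S stable under scaling this is the subspace spanned by S, in the form in
    which it is consumed: by induction on the number of summands. *)
Inductive sums (W : nmodType) (S : set W) : W -> Prop :=
| sums_nil : sums S 0
| sums_cons x y : S x -> sums S y -> sums S (x + y).

Section Sums.
Variable W : nmodType.
Implicit Types S : set W.

Lemma sums_one S x : S x -> sums S x.
Proof. by move=> Sx; rewrite -[x]addr0; apply: sums_cons => //; exact: sums_nil. Qed.

Lemma sumsD S x y : sums S x -> sums S y -> sums S (x + y).
Proof.
by elim=> [|a b Sa _ IH] Sy; rewrite ?add0r // -addrA; apply: sums_cons => //; exact: IH.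
Qed.

Lemma sums_sum S (I : eqType) (s : seq I) (F : I -> W) :
  (forall i, i \in s -> sums S (F i)) -> sums S (\sum_(i <- s) F i).
Proof.
elim: s => [|i s IH] H; first by rewrite big_nil; exact: sums_nil.
rewrite big_cons; apply: sumsD; first by apply: H; rewrite mem_head.
by apply: IH => j js; apply: H; rewrite inE js orbT.
Qed.

End Sums.

Lemma direct_sum_sums (K : fieldType) (U : lmodType K) (I : choiceType)
    (A : I -> set U) (w : U) :
  is_direct_sum A -> sums [set x | exists i, A i x] w.
Proof.
move=> /(_ w)[x [[Ax _ ->] _]]; apply: sums_sum => i _.
by apply: sums_one; exists i.
Qed.

Lemma sums_bind (W W' : nmodType) (S : set W) (S' : set W') (f : W -> W') :
  f 0 = 0 -> {morph f : x y / x + y} ->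
  (forall x, S x -> sums S' (f x)) -> forall x, sums S x -> sums S' (f x).
Proof.
move=> f0 fD H x; elim=> [|a b Sa _ IH]; first by rewrite f0; exact: sums_nil.
by rewrite fD; apply: sumsD => //; exact: H.
Qed.

Section Eigenvectors.
Variables (K : fieldType) (W : lmodType K) (f : {linear W -> W}).

Lemma eigenD a x y :
  eigenspace_of f a x -> eigenspace_of f a y -> eigenspace_of f a (x + y).
Proof. by rewrite /eigenspace_of /= => fx fy; rewrite linearD /= fx fy scalerDr. Qed.

Lemma eigenZ a c x : eigenspace_of f a x -> eigenspace_of f a (c *: x).
Proof. by rewrite /eigenspace_of /= => fx; rewrite linearZ /= fx !scalerA mulrC. Qed.

Lemma eigen0 a : eigenspace_of f a 0.
Proof. by rewrite /eigenspace_of /= linear0 scaler0. Qed.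

Lemma eigen_subspace a : is_subspace (eigenspace_of f a).
Proof. by split=> [|c x y ax ay]; [exact: eigen0 | apply/eigenD/ay/eigenZ]. Qed.

(** Applying f - b to a vanishing sum removes the eigenvector of eigenvalue b
    and rescales the others by nonzero factors. *)
Lemma eigen_indep (s : seq K) (y : K -> W) :
  uniq s -> (forall a, eigenspace_of f a (y a)) ->
  \sum_(a <- s) y a = 0 -> forall a, a \in s -> y a = 0.
Proof.
elim: s y => [|b s IH] y //= /andP[bs us] fy.
rewrite big_cons => sum0.
have sum_shift : \sum_(c <- s) (c - b) *: y c = 0.
  transitivity (\sum_(c <- s) (f (y c) - b *: y c)).
    by apply: eq_bigr => c _; rewrite fy scalerBl.
  have : f (y b + \sum_(c <- s) y c) - b *: (y b + \sum_(c <- s) y c) = 0.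
    by rewrite sum0 linear0 scaler0 subrr.
  rewrite linearD linear_sum /= scalerDr scaler_sumr fy opprD addrACA subrr add0r.
  by rewrite sumrB.
have tail0 a : a \in s -> y a = 0.
  move=> a_s; have := IH (fun c => (c - b) *: y c) us _ sum_shift a a_s.
  move=> /(_ (fun c => eigenZ (c - b) (fy c))) /eqP.
  rewrite scaler_eq0 subr_eq0 => /orP[/eqP ab|/eqP//].
  by rewrite -ab a_s in bs.
move=> a; rewrite inE => /predU1P[->|/tail0//].
by move: sum0; rewrite big1_seq ?addr0 // => c /andP[_ /tail0].
Qed.

(** Eigenvectors for distinct eigenvalues are independent, so a decomposition
    into eigenvectors is unique once those with equal eigenvalues are merged. *)
Lemma eigen_direct_sum :
  (forall w, sums [set x | exists a, eigenspace_of f a x] w) ->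
  is_direct_sum (eigenspace_of f).
Proof.
move=> H w; have [s [x [xe w_sum xs]]] : exists (s : seq K) (x : K -> W),
    [/\ forall a, eigenspace_of f a (x a), w = \sum_(a <- undup s) x a
      & forall a, a \notin s -> x a = 0].
  elim: (H w) => [|u v [b fu] _ [s [x [xe -> xs]]]].
    exists [::], (fun=> 0); split=> //; last by rewrite big_nil.
    by move=> a; exact: eigen0.
  exists (b :: s), (fun a => x a + (if a == b then u else 0)); split.
  - move=> a; apply: eigenD => //.
    by case: eqVneq => [->//|_]; exact: eigen0.
  - rewrite [RHS](_ : _ = \sum_(a <- undup (b :: s)) x a
        + \sum_(a <- undup (b :: s)) (if a == b then u else 0)) ?big_split //=.
    have -> : \sum_(a <- undup (b :: s)) (if a == b then u else 0) = u.
      rewrite (bigD1_seq b) ?undup_uniq ?mem_undup ?mem_head //= eqxx.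
      by rewrite big1 ?addr0 // => a /negPf->.
    rewrite addrC; congr (_ + _); rewrite /=; case: ifP => // bs.
    by rewrite big_cons xs ?add0r // bs.
  - move=> a; rewrite inE negb_or => /andP[/negPf-> /xs->].
    by rewrite addr0.
have fin (z : K -> W) : finite_set [set i | z i != 0] ->
    exists t : seq K, uniq t /\ forall i, i \notin t -> z i = 0.
  move=> /finite_fsetP[X eX]; exists X; split; first exact: fset_uniq.
  move=> i iX; apply/eqP/negPn/negP => zi; move/negP: iX; apply.
  by have : [set` X] i by rewrite -eX.
have fsE (z : K -> W) (t : seq K) : uniq t -> (forall i, i \notin t -> z i = 0) ->
    \sum_(i \in [set: K]) z i = \sum_(i <- t) z i.
  move=> ut zt; rewrite (fsbigTE [fset i in t]%fset) => [|i]; last first.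
    by rewrite inE /=; exact: zt.
  apply: perm_big; apply: uniq_perm => // i; by rewrite !inE.
have us : uniq (undup s) by exact: undup_uniq.
exists x; split.
  split=> //; first apply: (finite_subfset [fset i in s]%fset) => i /=.
    by apply: contraNP => /negP; rewrite inE /= => /xs/eqP.
  by rewrite (fsE _ (undup s)) // => i; rewrite mem_undup; exact: xs.
move=> z [ze zfin wz]; have [t [ut zt]] := fin _ zfin.
apply/funext => a; apply/eqP; rewrite -subr_eq0; apply/eqP.
have [a_in|] := boolP (a \in undup (t ++ s)); last first.
  by rewrite mem_undup mem_cat negb_or => /andP[/zt-> /xs->]; rewrite subrr.
apply: (eigen_indep (y := fun b => x b - z b) (undup_uniq (t ++ s)) _ _ a_in).
  by move=> b; rewrite -scaleN1r; apply: eigenD => //; exact: eigenZ.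
rewrite big_split /= sumrN -!fsE ?undup_uniq //.
- rewrite -wz w_sum (fsE _ (undup s)) ?subrr // => i.
  by rewrite mem_undup; exact: xs.
- by move=> i; rewrite mem_undup mem_cat negb_or => /andP[/zt].
- by move=> i; rewrite mem_undup mem_cat negb_or => /andP[_ /xs].
Qed.

End Eigenvectors.

(** * Finite-dimensional subspaces *)

Section FiniteDimension.
Variables (K : fieldType) (W : lmodType K).
Implicit Types A B : set W.

Definition fd_bounded A := exists2 B, A `<=` B & finite_dimensional B.

Lemma fd_boundedD A B : fd_bounded A -> fd_bounded B ->
  fd_bounded [set w | exists x y, [/\ A x, B y & w = x + y]].
Proof.
move=> [A' sA [m [a defA]]] [B' sB [n [b defB]]].
pose c (k : 'I_(m + n)) := match fintype.split k with inl i => a i | inr j => b j end.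
exists [set w | exists k : 'I_(m + n) -> K, w = \sum_(i < m + n) k i *: c i];
  last by exists (m + n)%N, c.
move=> _ [x [y [/sA + /sB + ->]]]; rewrite defA defB => -[k ->] [l ->].
exists (fun i => match fintype.split i with inl i => k i | inr j => l j end).
rewrite big_split_ord /c; congr (_ + _); apply: eq_bigr => i _.
  by rewrite (unsplitK (inl i)).
by rewrite (unsplitK (inr i)).
Qed.

(** Choose a matrix of maximal rank whose rows are coordinates, with respect to
    a spanning family b of the ambient space, of vectors of A.  Adding to its
    row space the coordinates of another vector of A cannot raise the rank, so
    its rows give a spanning family of A. *)
Lemma fd_bounded_subspace A : is_subspace A -> fd_bounded A ->
  finite_dimensional A.
Proof.
move=> [A0 AD] [B sAB [n [b defB]]]; rewrite defB in sAB.
pose ev (c : 'rV[K]_n) := \sum_(i < n) c 0 i *: b i.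
pose good (r : nat) :=
  `[< exists M : 'M[K]_n, \rank M = r /\ forall i, A (ev (row i M)) >].
have good0 : exists r, good r.
  exists 0%N; apply/asboolP; exists 0; rewrite mxrank0; split=> // i.
  by rewrite row0 /ev big1 // => j _; rewrite mxE scale0r.
have goodn r : good r -> (r <= n)%N.
  by move=> /asboolP[M [<- _]]; exact: rank_leq_col.
have [r /asboolP[M [rM AM]] rmax] := ex_maxnP good0 goodn.
have evlin (m : nat) (d : 'rV[K]_m) (N : 'M[K]_(m, n)) :
    ev (d *m N) = \sum_i d 0 i *: ev (row i N).
  rewrite /ev; under [RHS]eq_bigr do rewrite scaler_sumr.
  rewrite exchange_big /=; apply: eq_bigr => j _.
  rewrite mxE scaler_suml; apply: eq_bigr => i _.
  by rewrite scalerA !mxE.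
have Asum (m : nat) (d : 'I_m -> K) (y : 'I_m -> W) :
    (forall i, A (y i)) -> A (\sum_i d i *: y i).
  move=> Ay; elim/big_ind: _ => // [u v Au Av|i _].
    by rewrite -[u]scale1r; exact: AD.
  by rewrite -[_ *: _]addr0; exact: AD.
exists n, (fun i => ev (row i M)); apply/seteqP; split=> [w Aw|_ [d ->]];
  last exact: Asum.
have [c defw] := sAB _ Aw; pose v := \row_i c i.
have evv : w = ev v by rewrite defw; apply: eq_bigr => i _; rewrite mxE.
have vM : (v <= M)%MS.
  pose N := (v + M)%MS; have [D defD] : exists D, N = D *m col_mx v M.
    by apply/submxP; rewrite /N addsmxE.
  have goodN : good (\rank N).
    apply/asboolP; exists N; split=> // i.
    rewrite defD row_mul evlin; apply: Asum => j.
    case: (fintype.splitP j) => k jk.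
      have -> : j = lshift n k by apply: val_inj.
      by rewrite (ord1 k) rowKu row_id -evv.
    have -> : j = rshift 1 k by apply: val_inj.
    by rewrite rowKd.
  have := rmax _ goodN; rewrite -rM => leNM.
  have sMN : (M <= N)%MS by rewrite addsmxSr.
  by rewrite (submx_trans (addsmxSl v M)) // -(geq_leqif (mxrank_leqif_sup sMN)).
have [d defv] := submxP vM.
by exists (fun i => d 0 i); rewrite evv defv evlin.
Qed.

End FiniteDimension.

(** * Annihilating polynomials on finite-dimensional subspaces *)

Section Annihilator.
Variables (K : fieldType) (W : lmodType K) (f : {linear W -> W}).

Definition shift (a : K) (w : W) := f w - a *: w.

(** The operator p(f) for p the product of the polynomials X - a, a in s. *)
Definition roots_at (s : seq K) (w : W) := foldr shift w s.

Lemma roots_at_cons a s w : roots_at (a :: s) w = shift a (roots_at s w).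
Proof. by []. Qed.

Lemma shift_linear a : linear (shift a).
Proof.
move=> c x y; rewrite /shift linearP scalerDr !scalerA [a * c]mulrC scalerBr.
by rewrite !scalerA opprD addrACA.
Qed.

Lemma roots_at_linear s : linear (roots_at s).
Proof.
elim: s => [|a s IH] c x y //.
by rewrite !roots_at_cons IH shift_linear.
Qed.

HB.instance Definition _ s :=
  GRing.isLinear.Build K W W _ (roots_at s) (roots_at_linear s).

Lemma roots_at_cat s t w : roots_at (s ++ t) w = roots_at s (roots_at t w).
Proof. by rewrite /roots_at foldr_cat. Qed.

Lemma shiftC a b w : shift a (shift b w) = shift b (shift a w).
Proof.
rewrite /shift !linearB !linearZ /= !scalerA [b * a]mulrC.
by rewrite addrACA.

Qed.

Lemma roots_at_shift s a w : roots_at s (shift a w) = shift a (roots_at s w).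
Proof. by elim: s => // b s IH; rewrite !roots_at_cons IH shiftC. Qed.

Lemma roots_atC s t w : roots_at s (roots_at t w) = roots_at t (roots_at s w).
Proof. by elim: t => // a t IH; rewrite !roots_at_cons roots_at_shift IH. Qed.

Lemma roots_at_eigen s a w : eigenspace_of f a w -> w != 0 ->
  roots_at s w = 0 -> a \in s.
Proof.
move=> fw w0; have -> : roots_at s w = (\prod_(b <- s) (a - b)) *: w.
  elim: s => [|b s IH]; first by rewrite big_nil scale1r.
  rewrite roots_at_cons IH /shift linearZ /= fw !scalerA big_cons -scalerBl.
  by congr (_ *: _); ring.
move=> /eqP; rewrite scaler_eq0 (negPf w0) orbF => /eqP p0.
have : root (\prod_(b <- s) ('X - b%:P)) a.
  rewrite /root horner_prod; apply/eqP; rewrite -p0.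
  by apply: eq_bigr => b _; rewrite !hornerE.
by rewrite root_prod_XsubC.
Qed.

(** The last nonzero vector obtained by applying the factors f - a one after the
    other is an eigenvector. *)
Lemma roots_at_eigenvector (A : set W) s w :
  is_subspace A -> (forall x, A x -> A (f x)) -> A w -> w != 0 ->
  roots_at s w = 0 -> exists a z, [/\ A z, z != 0 & eigenspace_of f a z].
Proof.
move=> [A0 AD] Af; elim: s => [|a s IH] Aw w0; first by move=> /eqP; rewrite (negPf w0).
rewrite roots_at_cons => sw0.
have [/eqP/IH|sw_neq0] := boolP (roots_at s w == 0); first exact.
exists a, (roots_at s w); split=> //; last by apply/eqP; rewrite -subr_eq0; apply/eqP.
elim: s {IH sw0 sw_neq0} => // b s IH; rewrite roots_at_cons /shift addrC -scaleNr.
by apply: AD => //; exact: Af.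
Qed.

End Annihilator.

Lemma roots_at_horner (K : fieldType) (W : lmodType K) (f : {linear W -> W})
    (s : seq K) (w : W) (n : nat) : (size s < n)%N ->
  roots_at f s w =
  \sum_(i < n) (\prod_(a <- s) ('X - a%:P))`_i *: iter i f w.
Proof.
elim: s n => [|a s IH] [|n] // sn.
  rewrite big_nil big_ord_recl coefC /= scale1r big1 ?addr0 // => i _.
  by rewrite coefC /= scale0r.
rewrite big_cons; set p := \prod_(a <- s) _ in IH *.
have szp : (size p <= n)%N by rewrite size_prod_XsubC.
rewrite roots_at_cons (IH n) // /shift linear_sum /=.
under [RHS]eq_bigr => i _ do rewrite mulrBl coefB coefXM coefCM scalerBl.
rewrite big_split sumrN /=; congr (_ - _).
  rewrite big_ord_recl /= scale0r add0r.
  by apply: eq_bigr => i _; rewrite linearZ.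
rewrite big_ord_recr /= [p`_n]nth_default // mulr0 scale0r addr0 scaler_sumr.
by apply: eq_bigr => i _; rewrite scalerA.
Qed.

(** Over a closed field the dependency among the iterates of a vector in a
    finite-dimensional stable subspace is a polynomial that splits, so the
    vector is killed by finitely many factors of the form f - a; the factors
    for the vectors of a basis together kill the subspace. *)
Lemma roots_at_exists (K : closedFieldType) (W : lmodType K)
    (f : {linear W -> W}) (A : set W) :
  finite_dimensional A -> (forall x, A x -> A (f x)) ->
  exists s, forall x, A x -> roots_at f s x = 0.
Proof.
move=> [n [b defA]] Af.
have one x : A x -> exists s, roots_at f s x = 0.
  move=> Ax.
  have Aiter k : A (iter k f x) by elim: k => //= k; exact: Af.
  have /boolp.choice[C defC] (k : 'I_n.+1) :
      exists c : 'I_n -> K, iter k f x = \sum_(i < n) c i *: b i.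
    by have := Aiter k; rewrite {1}defA.
  pose M := \matrix_(k < n.+1, i < n) C k i.
  have /rowV0Pn[v /sub_kermxP vM v0] : kermx M != 0.
    rewrite kermx_eq0 /row_free; apply/eqP => rM.
    by have := rank_leq_col M; rewrite rM ltnn.
  pose p := \poly_(i < n.+1) v 0 (inord i).
  have pE (i : 'I_n.+1) : p`_i = v 0 i by rewrite coef_poly ltn_ord inord_val.
  have px : \sum_(i < n.+1) p`_i *: iter i f x = 0.
    under eq_bigr => i _ do rewrite pE defC scaler_sumr.
    rewrite exchange_big /= big1 // => j _.
    under eq_bigr => i _ do rewrite scalerA.
    rewrite -scaler_suml; have /rowP/(_ j) := vM; rewrite !mxE => vMj.
    rewrite [X in X *: _](_ : _ = 0) ?scale0r // -[RHS]vMj.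
    by apply: eq_bigr => i _; rewrite mxE.
  have p0 : p != 0.
    apply: contraNneq v0 => p0; apply/eqP/rowP => i.
    by rewrite -pE p0 coef0 mxE.
  have [s defp] := closed_field_poly_normal p; exists s.
  have sn : (size s < n.+1)%N.
    have := size_poly n.+1 (fun i => v 0 (inord i)); rewrite -/p defp.
    by rewrite size_scale ?lead_coef_eq0 // size_prod_XsubC.
  apply: (@scalerI _ _ (lead_coef p)); first by rewrite lead_coef_eq0.
  rewrite scaler0 (roots_at_horner _ _ sn) -[RHS]px scaler_sumr.
  by apply: eq_bigr => i _; rewrite [in RHS]defp coefZ scalerA.
have Ab i : A (b i).
  rewrite defA; exists (fun j => (j == i)%:R); rewrite (bigD1 i) //= eqxx scale1r.
  by rewrite big1 ?addr0 // => j /negPf->; rewrite scale0r.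
have /boolp.choice[s bs] (i : 'I_n) : exists s, roots_at f s (b i) = 0.
  exact: one.
exists (flatten [seq s i | i <- enum 'I_n]) => x; rewrite defA => -[c ->].
rewrite linear_sum big1 // => i _; rewrite linearZ /=.
have : i \in enum 'I_n by rewrite mem_enum.
elim: (enum 'I_n) => //= j e IH; rewrite inE roots_at_cat => /predU1P[<-|/IH].
  by rewrite roots_atC bs linear0 scaler0.
move=> /eqP; rewrite scaler_eq0 => /orP[/eqP->|/eqP->].
  by rewrite scale0r.
by rewrite linear0 scaler0.
Qed.

(** * Homogeneous vectors of a vertex operator algebra *)

Section RootsOfUnity.
Variables (R : realType) (T : nat).
Hypothesis T_gt0 : (0 < T)%N.

Let T_neq0 : (T%:R : R) != 0.
Proof. by rewrite pnatr_eq0 -lt0n. Qed.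

Lemma unity_rootX r : unity_root R T r = unity_root R T 1 ^+ r.
Proof.
elim: r => [|r IH].
  by rewrite /unity_root mulr0 mul0r oppr0 cos0 sin0 expr0.
rewrite exprSr -IH /unity_root.
have -> : - (2 * pi * r.+1%:R / T%:R) =
    - (2 * pi * r%:R / T%:R) + - (2 * pi * 1%:R / T%:R) :> R.
  by rewrite -[in r.+1%:R]addn1 natrD; field.
by rewrite cosD sinD; apply/eqP; rewrite eq_complex /= eqxx addrC eqxx.
Qed.

Lemma unity_root_order : unity_root R T 1 ^+ T = 1.
Proof.
rewrite -unity_rootX /unity_root mulfK // cosN sinN mulr_natl.
by rewrite cos2pi sin2pi oppr0.
Qed.

(** With x = pi k / T one has 1 - cos (2 x) = 2 (sin x)^2, which is positive
    since x lies strictly between 0 and pi. *)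
Lemma unity_root_neq1 k : (0 < k < T)%N -> unity_root R T 1 ^+ k != 1.
Proof.
move=> /andP[k0 kT]; rewrite -unity_rootX /unity_root.
set x : R := pi * k%:R / T%:R.
have -> : 2 * pi * k%:R / T%:R = x *+ 2 :> R by rewrite /x -mulr_natl; field.
have x0 : 0 < x < pi.
  have T0 : 0 < T%:R :> R by rewrite ltr0n.
  have pi0 := pi_gt0 R.
  rewrite /x divr_gt0 ?mulr_gt0 ?ltr0n //=.
  by rewrite ltr_pdivrMr // ltr_pM2l // ltr_nat.
rewrite eq_complex /= negb_and cosN cos_mulr2n subr_eq addrC.
have := sin_gt0_pi x0; have := cos2Dsin2 x; have -> : (1 + 1 = 2 :> R) by [].
set c := cos x; set s := sin x => cs s0.
apply/orP; left; apply/negP => /eqP; nra.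
Qed.

Lemma sum_powers_root (y : R[i]) : y ^+ T = 1 -> y != 1 ->
  \sum_(r < T) y ^+ r = 0.
Proof.
move=> yT y1; apply: (mulfI (x := y - 1)); first by rewrite subr_eq0.
by rewrite -subrX1 yT subrr mulr0.
Qed.

End RootsOfUnity.

Section Sectors.
Variables (R : realType) (V : vertexAlgebra R) (g : {linear V -> V}) (T : nat).
Hypothesis g_order : has_order g T.

(** Averaging the powers of g against the characters of the cyclic group of
    order T projects a vector to the sectors; the projections stay in every
    g-stable subspace, so the sector decomposition refines any decomposition
    into g-stable subspaces, such as the grading by conformal weight. *)
Lemma sector_decomposition (A : set V) v :
  is_subspace A -> (forall x, A x -> A (g x)) -> A v ->
  sums [set x | A x /\ exists2 r, (r < T)%N & twist_sector g T r x] v.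
Proof.
move=> [A0 AD] Ag Av; have [T0 gT _] := g_order.
pose z : R[i] := unity_root R T 1.
have zT : z ^+ T = 1 by exact: unity_root_order.
have z0 : z != 0.
  by apply/eqP => z0; have := zT; rewrite z0 expr0n eqn0Ngt T0 => /eqP;
    rewrite eq_sym oner_eq0.
have T_neq0 : (T%:R : R[i]) != 0 by rewrite pnatr_eq0 -lt0n.
pose S r := \sum_(k < T) ((z ^+ r)^-1) ^+ k *: iter k g v.
have -> : v = \sum_(r <- enum 'I_T) T%:R^-1 *: S r.
  rewrite -scaler_sumr big_enum /= /S exchange_big /=.
  under eq_bigr => k _ do rewrite -scaler_suml.
  rewrite (bigD1 (Ordinal T0)) //= [X in _ + X]big1 ?addr0 => [|k k0].
    under eq_bigr => r _ do rewrite expr0.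
    by rewrite sumr_const card_ord scalerA mulVf // scale1r.
  have -> : \sum_(r < T) ((z ^+ r)^-1) ^+ k = 0; last by rewrite scale0r.
  transitivity (\sum_(r < T) (z ^+ k)^-1 ^+ r).
    by apply: eq_bigr => r _; rewrite !exprVn -!exprM mulnC.
  apply: sum_powers_root; first by rewrite exprVn -exprM mulnC exprM zT expr1n invr1.
  rewrite invr_eq1; apply: unity_root_neq1 => //; rewrite ltn_ord andbT lt0n.
  by apply: contra k0 => /eqP k0; apply/eqP/val_inj.
apply: sums_sum => r _; apply: sums_one; split.
  rewrite -[_ *: _]addr0; apply: (AD) => //; rewrite /S.
  elim/big_ind: _ => // [x y Ax Ay|k _].
    by rewrite -[x]scale1r; exact: AD.
  rewrite -[_ *: _]addr0; apply: AD => //.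
  by elim: (k : nat) => //= j; exact: Ag.
exists r => //; apply: eigenZ; rewrite /eigenspace_of /= unity_rootX -/z //.
(* Multiplication by c^-1 after g shifts the terms of S r cyclically. *)
set c := z ^+ r; have c0 : c != 0 by rewrite expf_neq0.
have cT : c^-1 ^+ T = 1 by rewrite exprVn -exprM mulnC exprM zT expr1n invr1.
apply: (@scalerI _ _ c^-1); first by rewrite invr_eq0.
rewrite scalerA mulVf // scale1r /S -/c linear_sum scaler_sumr /=.
under eq_bigr => k _ do rewrite linearZ scalerA -exprS /= -iterS.
case: T T0 gT cT => // t _ gT cT; rewrite big_ord_recr [RHS]big_ord_recl /=.
by rewrite cT expr0 !scale1r -iterS gT addrC.
Qed.

End Sectors.

Section Homogeneous.
Variables (R : realType) (V : vertexAlgebra R) (g : {linear V -> V}) (T : nat).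

Definition homogeneous (omega : V) (r : nat) (a : int) : set V :=
  twist_sector g T r `&` eigenspace_of (vir omega 0) a%:~R.

(** L(0) commutes with g since g fixes omega, so each eigenspace of L(0) splits
    into its intersections with the sectors. *)
Lemma homogeneous_decomposition omega v :
  has_order g T -> is_voa omega -> is_voa_automorphism omega g ->
  sums [set x | exists r a, (r < T)%N /\ homogeneous omega r a x] v.
Proof.
move=> g_order [[_ _ L0_ss _] L0_int _ _] [_ _ gY g_omega].
have := direct_sum_sums v L0_ss; apply: (sums_bind (f := idfun)) => // x [a ax].
have [->|/eqP x0] := eqVneq x 0; first exact: sums_nil.
have [n defa] : exists n : int, a = n%:~R.
  apply: contrapT => /forallNP na; have /(_ na) := L0_int a.
  by move=> /seteqP[/(_ _ ax)].
rewrite defa in ax.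
have := sector_decomposition g_order (A := eigenspace_of (va_mode omega (0 + 1)) n%:~R).
move=> /(_ x (eigen_subspace _ _) _ ax) /= H.
apply: (sums_bind (f := idfun)) (H _) => // [y [ny [r rT ry]]|y].
  by apply: sums_one; exists r, n.
by rewrite /eigenspace_of /= -{2}g_omega -gY => ->; rewrite linearZ.
Qed.

End Homogeneous.

(** * Mode identities on twisted modules *)

(** A sum over all of nat is evaluated only after a bound on its support is
    known, since it is 0 by convention when the support is infinite. *)
Lemma fsum_nat (W : nmodType) (F : nat -> W) (n : nat) :
  (forall i, (n <= i)%N -> F i = 0) ->
  \sum_(i \in [set: nat]) F i = \sum_(i < n) F i.
Proof.
move=> F0; rewrite (fsbigTE [fset i in iota 0 n]%fset) => [|i]; last first.
  by rewrite !inE mem_iota /= add0n -leqNgt; exact: F0.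
rewrite -(big_mkord xpredT F) /index_iota subn0.
by apply: perm_big; apply: uniq_perm; rewrite ?iota_uniq // => i; rewrite !inE.
Qed.

Section Binexp.
Variable K : numFieldType.

Lemma binexp0 (q : K) : binexp q 0 = 1.
Proof. by rewrite /binexp big_ord0 expr0 !mul1r invr1. Qed.

Lemma binexp1 (q : K) : binexp q 1 = - q.
Proof. by rewrite /binexp big_ord1 expr1 subr0 divr1 mulN1r. Qed.

Lemma binexp_nat_eq0 (k i : nat) : (k < i)%N -> binexp (k%:R : K) i = 0.
Proof.
by move=> ki; rewrite /binexp (bigD1 (Ordinal ki)) //= subrr mul0r mulr0 mul0r.
Qed.

Lemma binexp_0 i : (0 < i)%N -> binexp (0 : K) i = 0.
Proof. exact: (@binexp_nat_eq0 0). Qed.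

End Binexp.

Section Modes.
Variables (R : realType) (V : vertexAlgebra R) (g : {linear V -> V}) (T : nat).
Variable M : weakTwistedModule g T.
Implicit Types (u v : V) (w : M).

Lemma tm_modeD u v n w :
  tm_mode M (u + v) n w = tm_mode M u n w + tm_mode M v n w.
Proof. by have := tm_mode_linear n w 1 u v; rewrite !scale1r. Qed.

Lemma tm_mode0 n w : tm_mode M 0 n w = 0.
Proof. by have := tm_mode_linear n w (-1) 0 0; rewrite scaler0 addr0 scaleN1r addNr. Qed.

Lemma tm_modeZ a u n w : tm_mode M (a *: u) n w = a *: tm_mode M u n w.
Proof. by have := tm_mode_linear n w a u 0; rewrite !addr0 tm_mode0 addr0. Qed.

(** The Jacobi identity with l = 0, where (z1 - z2)^0 contributes one term to
    each of the two products. *)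
Lemma tm_commutator r u v w (p : int) (n : rat) : (r < T)%N ->
  twist_sector g T r u ->
  let m : rat := r%:R / T%:R + p%:~R in
  tm_mode M u m (tm_mode M v n w) - tm_mode M v n (tm_mode M u m w) =
  \sum_(i \in [set: nat]) binexp (ratr (i%:R - m - 1)) i *:
    tm_mode M (va_mode u i%:Z v) (m + n - i%:R) w.
Proof.
move=> rT ur m; have := tm_jacobi v w 0 p n rT ur; rewrite -/m /=.
rewrite (@fsum_nat _ _ 1) ?big_ord1; last first.
  by move=> i i0; rewrite binexp_0 // scale0r.
rewrite (@fsum_nat _ _ 1) ?big_ord1; last first.
  by move=> i i0; rewrite binexp_0 // mulr0 scale0r.
rewrite /= expr0z mul1r binexp0 !scale1r !(mulr0z, mulr0n, subr0, addr0) => ->.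
by apply: eq_fsbigr => i _; rewrite add0r.
Qed.

(** The Jacobi identity with v = 1, l = -2 and n = 0: the mode of 1 of index -1,
    the only nonzero one, occurs in neither product, and only u_(-2) 1 and
    u_(-1) 1 survive on the other side. *)
Lemma tm_mode_derivative r u w (p : int) : (r < T)%N -> twist_sector g T r u ->
  let m : rat := r%:R / T%:R + p%:~R in
  tm_mode M (va_D u) m w = - ratr m *: tm_mode M u (m - 1) w.
Proof.
move=> rT ur m; have := tm_jacobi (va_one V) w (-2) p 0 rT ur; rewrite -/m /=.
have natN (i : nat) : (i%:R == -1 :> rat) = false.
  by apply/negP => /eqP i1; have := ler0n rat i; rewrite i1 ler0N1.
have natN2 (i : nat) : (0 + (-2)%:~R - i%:R == -1 :> rat) = false.
  apply/negP => /eqP i1; have := ler0n rat i; rewrite leNgt => /negP; apply.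
  by rewrite (_ : i%:R = -1) ?ltrN10 //; move: i1; rewrite add0r; lra.
rewrite fsbig1 => [|i _]; last by rewrite tm_one_mode add0r natN linear0 scaler0.
rewrite fsbig1 => [|i _]; last by rewrite tm_one_mode natN2 scaler0.
rewrite (@fsum_nat _ _ 2) => [|i i2]; last first.
  rewrite va_creation; last by lia.
  by rewrite ifF ?tm_mode0 ?scaler0 //; apply/eqP; lia.
rewrite big_ord_recr big_ord1 /= binexp0 binexp1 scale1r !(mulr0n, subr0, addr0).
have -> : va_mode u (-2 + 1%Z) (va_one V) = u by rewrite va_creation.
move=> /esym/eqP; rewrite addr_eq0 => /eqP->.
by rewrite -scaleNr opprK; congr (_ *: _); rewrite -rmorphN; congr ratr; ring.
Qed.

(** The commutator of L(0) = omega_1 with v_n is (omega_0 v)_(n+1) +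
    (omega_1 v)_n; here omega_0 v = L(-1) v is the derivative of v, whose modes
    are multiples of those of v, and omega_1 v = a v. *)
Lemma tm_L0_homogeneous omega r (a : int) v n w : (r < T)%N ->
  is_voa omega -> is_voa_automorphism omega g -> homogeneous g T omega r a v ->
  let L0 : {linear M -> M} := tm_mode M omega (0 + 1)%:~R in
  L0 (tm_mode M v n w) =
  tm_mode M v n (L0 w) + (a%:~R - ratr n - 1) *: tm_mode M v n w.
Proof.
move=> rT [[_ LD _ _] _ _ _] [_ g_one gY g_omega] [vr va] L0.
have T0 : (0 < T)%N by case: (T) rT.
have omega0 : twist_sector g T 0 omega.
  by rewrite /twist_sector /eigenspace_of /= unity_rootX // expr0 scale1r.
have mE : 0%:R / T%:R + 1%:~R = (0 + 1)%:~R :> rat by rewrite mul0r add0r.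
have := tm_commutator v w 1 n T0 omega0; rewrite /= mE -/L0.
have m1 : (0 + 1)%:~R = 1 :> rat by [].
rewrite (@fsum_nat _ _ 2) => [|[|[|i]] //= _]; last first.
  have -> : i.+2%:R - (0 + 1)%:~R - 1 = i%:R :> rat.
    by rewrite m1 -addn2 natrD; ring.
  by rewrite ratr_nat binexp_nat_eq0 ?scale0r.
rewrite big_ord_recr big_ord1 /= binexp0 binexp1 scale1r m1 subr0.
have -> : 1 - 1 - 1 = -1 :> rat by ring.
rewrite rmorphN1 opprK scale1r.
have -> : va_mode omega 0 v = va_D v by rewrite -LD /vir; congr (va_mode _ _ _).
have -> : va_mode omega 1 v = a%:~R *: v by rewrite -va.
rewrite tm_modeZ => /eqP; rewrite subr_eq => /eqP->; rewrite [LHS]addrC; congr (_ + _).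
have [[p np]|notin] := pselect (exists p : int, n = r%:R / T%:R + p%:~R).
  have e : 1 + n = r%:R / T%:R + (p + 1)%:~R by rewrite np intrD; ring.
  have := tm_mode_derivative w (p + 1) rT vr; rewrite /= -e => ->.
  have -> : 1 + n - 1 = n by ring.
  by rewrite -scalerDl rmorphD rmorph1; congr (_ *: _); ring.
(* Off the coset r/T + Z both v_n and the derivative's mode vanish. *)
have n0 x : tm_mode M v n x = 0.
  by apply: (tm_support x rT vr) => p np; apply: notin; exists p.
have -> : 1 + n - 1 = n by ring.
rewrite n0 !scaler0 addr0.
apply: (tm_support w rT (_ : twist_sector g T r (va_D v))) => [|p np].
  rewrite /twist_sector /eigenspace_of /= /va_D gY g_one vr.
  have := va_mode_linear (-2) (va_one V) (unity_root R T r) v 0.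
  have := va_mode_linear (-2) (va_one V) (-1) 0 0.
  by rewrite scaler0 addr0 scaleN1r addNr => -> ; rewrite !addr0.
by apply: notin; exists (p - 1); rewrite intrB addrA -np; ring.
Qed.

Lemma eigen_mode omega r (a : int) v n mu w : (r < T)%N ->
  is_voa omega -> is_voa_automorphism omega g -> homogeneous g T omega r a v ->
  let L0 : {linear M -> M} := tm_mode M omega (0 + 1)%:~R in
  eigenspace_of L0 mu w ->
  eigenspace_of L0 (mu + (a%:~R - ratr n - 1)) (tm_mode M v n w).
Proof.
move=> rT omega_voa omega_aut va L0 muw; rewrite /eigenspace_of /=.
by rewrite (tm_L0_homogeneous _ _ rT omega_voa omega_aut va) /= muw linearZ
  [RHS]scalerDl.
Qed.

End Modes.

(** * Uniformly truncated families *)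

Section Truncation.
Variables (R : realType) (V : vertexAlgebra R) (g : {linear V -> V}) (T : nat).
Hypothesis g_order : has_order g T.
Variable M : weakTwistedModule g T.

Definition truncated (I : Type) (F : I -> M) (u : V) :=
  exists K : rat, forall n, K <= n -> forall i, tm_mode M u n (F i) = 0.

Definition uniformly_truncated (I : Type) (F : I -> M) :=
  forall u, truncated F u.

Lemma truncated_sums (I : Type) (F : I -> M) (S : set V) u :
  (forall x, S x -> truncated F x) -> sums S u -> truncated F u.
Proof.
move=> SF; elim=> [|x y /SF[K xK] _ [L yL]].
  by exists 0 => n _ i; exact: tm_mode0.
exists (Num.max K L) => n; rewrite ge_max => /andP[Kn Ln] i.
by rewrite tm_modeD xK // yL // addr0.
Qed.

Lemma truncated_sector (I : Type) (F : I -> M) r u : (r < T)%N ->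
  twist_sector g T r u ->
  (exists N : int, forall p : int, N <= p ->
     forall i, tm_mode M u (r%:R / T%:R + p%:~R) (F i) = 0) ->
  truncated F u.
Proof.
move=> rT ur [N uN]; exists (N%:~R + 1) => n Nn i.
have [[p np]|notin] := pselect (exists p : int, n = r%:R / T%:R + p%:~R).
  rewrite np uN //; have : N%:~R < p%:~R + 1 :> rat.
    have T0 : 0 < T%:R :> rat by rewrite ltr0n; case: (T) rT.
    have : r%:R / T%:R < 1 :> rat by rewrite ltr_pdivrMr // mul1r ltr_nat.
    by move: Nn; rewrite np; lra.
  by rewrite -[1]/(1%:~R) -intrD ltr_int ltzD1.
by apply: (tm_support _ rT ur) => p np; apply: notin; exists p.
Qed.

Lemma sums_sector (v : V) :
  sums [set x | exists2 r, (r < T)%N & twist_sector g T r x] v.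
Proof.
have := sector_decomposition g_order (A := [set: V]) (v := v).
move=> /(_ (conj I (fun _ _ _ _ _ => I)) (fun _ _ => I) I).
by apply: (sums_bind (f := idfun)) => // x [_ rx]; exact: sums_one.
Qed.

(** By the commutator formula a mode u_n with n large passes through v_m at the
    cost of the modes of finitely many vectors u_i v. *)
Lemma uniformly_truncated_mode (I : Type) (F : I -> M) v m :
  uniformly_truncated F -> uniformly_truncated (fun i => tm_mode M v m (F i)).
Proof.
move=> F_trunc u; apply: truncated_sums (sums_sector u) => {}u [r rT ur].
have [N uvN] := va_trunc u v.
have [K uK] : exists K : rat, forall j, (j < `|N|)%N -> forall n, K <= n ->
    forall i, tm_mode M (va_mode u j%:Z v) n (F i) = 0.
  elim: `|N|%N => [|k [K IH]]; first by exists 0.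
  have [L uL] := F_trunc (va_mode u k%:Z v).
  exists (Num.max K L) => j; rewrite ltnS leq_eqVlt => /predU1P[-> n|jk n];
    rewrite ge_max => /andP[Kn Ln] i; [exact: uL | exact: IH].
have [L uL] := F_trunc u.
apply: (truncated_sector rT ur).
exists (Num.max (Num.ceil L) (Num.ceil (K - m + `|N|%:R))) => p.
rewrite ge_max => /andP[Lp Kp] i.
have r0 : 0 <= r%:R / T%:R :> rat by rewrite divr_ge0.
have Lp' : L <= p%:~R by apply: le_trans (ceil_ge L) _; rewrite ler_int.
have Kp' : K - m + `|N|%:R <= p%:~R by apply: le_trans (ceil_ge _) _; rewrite ler_int.
have := tm_commutator v (F i) p m rT ur.
rewrite /= (uL (r%:R / T%:R + p%:~R)); last by lra.
rewrite [tm_mode M v m 0]linear0 subr0.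
move=> ->; rewrite fsbig1 // => j _.
have [jN|Nj] := ltnP j `|N|%N; last by rewrite uvN ?tm_mode0 ?scaler0 //; lia.
rewrite uK ?scaler0 //.
have : j%:R <= `|N|%:R :> rat by rewrite ler_nat ltnW.
by lra.
Qed.

End Truncation.

Section TruncatedPower.
Variables (R : realType) (V : vertexAlgebra R) (g : {linear V -> V}) (T : nat).
Variable M : weakTwistedModule g T.
Variable I : Type.

Definition truncated_pred : {pred (I -> M)} :=
  fun F => `[< uniformly_truncated F >].

Lemma truncated_submod_closed : submod_closed truncated_pred.
Proof.
split=> [|a F G /asboolP F_tr /asboolP G_tr]; apply/asboolP => u.
  by exists 0 => n _ i; rewrite linear0.
have [K uK] := F_tr u; have [L uL] := G_tr u.
exists (Num.max K L) => n; rewrite ge_max => /andP[Kn Ln] i.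
by rewrite linearP /= uK // uL // scaler0 addr0.
Qed.

HB.instance Definition _ :=
  GRing.isSubmodClosed.Build R[i] (I -> M) truncated_pred truncated_submod_closed.

Record truncated_power :=
  TruncatedPower { coords :> I -> M; _ : coords \in truncated_pred }.

HB.instance Definition _ := [isSub for coords].
HB.instance Definition _ := [Choice of truncated_power by <:].
HB.instance Definition _ := [SubChoice_isSubLmodule of truncated_power by <:].

End TruncatedPower.

Section PowerModule.
Variables (R : realType) (V : vertexAlgebra R) (g : {linear V -> V}) (T : nat).
Hypothesis g_order : has_order g T.
Variable M : weakTwistedModule g T.
Variable I : Type.
Local Notation P := (truncated_power M I).

Lemma coordsP (x : P) : uniformly_truncated (coords x).
Proof. by apply/asboolP; case: x. Qed.

Lemma truncated_power_eq (x y : P) : coords x = coords y -> x = y.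
Proof. exact: val_inj. Qed.

Definition power_mode (u : V) (n : rat) (x : P) : P :=
  TruncatedPower (introT (asboolP _)
    (uniformly_truncated_mode g_order u n (coordsP x))).

Lemma power_mode_linear u n : linear (power_mode u n).
Proof.
move=> a x y; apply: truncated_power_eq; apply/funext => i.
by rewrite /= [LHS]linearP.
Qed.

HB.instance Definition _ u n :=
  GRing.isLinear.Build R[i] P P _ (power_mode u n) (power_mode_linear u n).

(** The support of a family of sums contains that of every coordinate, so it has
    to be bounded uniformly for the two sums to agree. *)
Lemma coords_sum (F : nat -> P) :
  (exists n, forall j, (n <= j)%N -> F j = 0) ->
  forall i, coords (\sum_(j \in [set: nat]) F j) i =
    \sum_(j \in [set: nat]) coords (F j) i.
Proof.
move=> [n Fn] i; rewrite !(@fsum_nat _ _ n) => [||j /Fn->//].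
  by rewrite -[coords _]/(val _) raddf_sum fct_sumE.
by move=> j /Fn->.
Qed.

Lemma truncated_power_trunc u (x : P) :
  exists K : rat, forall n, K <= n -> power_mode u n x = 0.
Proof.
have [K uK] := coordsP x u; exists K => n Kn.
by apply: truncated_power_eq; apply/funext => i; exact: uK.
Qed.

Lemma nat_rat_bound (K m : rat) : exists n : nat, forall j, (n <= j)%N -> K <= m + j%:R.
Proof.
exists `|Num.ceil (K - m)|%N => j nj; rewrite -lerBlDl.
apply: le_trans (ceil_ge _) _; rewrite -[j%:R]/(j%:Z%:~R) ler_int.
by move: (Num.ceil _) nj => c; lia.
Qed.

(** The power of M over I satisfies every module axiom pointwise except
    truncation, which for a family means a bound uniform in the index. *)
Definition power_module : weakTwistedModule g T.
Proof.
refine (@WeakTwistedModule R V g T P (fun u n => power_mode u n) _ _ _ _ _).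
- move=> n x a u v; apply: truncated_power_eq; apply/funext => i /=.
  exact: tm_mode_linear.
- move=> r u n x rT ur np; apply: truncated_power_eq; apply/funext => i /=.
  exact: (tm_support _ rT ur).
- move=> n x; apply: truncated_power_eq; apply/funext => i /=.
  by rewrite tm_one_mode; case: ifP.
- move=> r u x rT ur; have [K uK] := truncated_power_trunc u x.
  exists (Num.ceil K) => n Kn; apply: uK.
  have r0 : 0 <= r%:R / T%:R :> rat by rewrite divr_ge0.
  have : K <= n%:~R by apply: le_trans (ceil_ge _) _; rewrite ler_int.
  by lra.
- move=> r u v x l p n rT ur m; apply: truncated_power_eq; apply/funext => i.
  rewrite [LHS](_ : _ = coords (\sum_(j \in [set: nat]) binexp l%:~R j *:
      power_mode u (m + l%:~R - j%:R) (power_mode v (n + j%:R) x)) i -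
    coords (\sum_(j \in [set: nat]) ((-1) ^ l * binexp l%:~R j) *:
      power_mode v (n + l%:~R - j%:R) (power_mode u (m + j%:R) x)) i) //.
  rewrite !coords_sum; first exact: tm_jacobi.
  + have [N uvN] := va_trunc u v; exists `|N - l|%N => j Nj.
    rewrite (uvN (l + j%:Z)); last by lia.
    rewrite [X in _ *: X](_ : _ = 0) ?scaler0 //.
    by apply: truncated_power_eq; apply/funext => k; exact: tm_mode0.
  + have [K uK] := truncated_power_trunc u x; have [N uN] := nat_rat_bound K m.
    by exists N => j /uN/uK->; rewrite linear0 scaler0.
  + have [K vK] := truncated_power_trunc v x; have [N vN] := nat_rat_bound K n.
    by exists N => j /vN/vK->; rewrite linear0 scaler0.
Defined.

End PowerModule.

(** * A finiteness consequence of regularity *)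

Section Finiteness.
Variables (R : realType) (V : vertexAlgebra R) (g : {linear V -> V}) (T : nat).
Hypothesis g_order : has_order g T.

(** Regularity is applied to the module of uniformly truncated families indexed
    by S, at the inclusion of S in M: being a finite sum of eigenvectors of
    L(0), it takes its values in finitely many eigenspaces of M. *)
Lemma truncated_set_fd omega (M : weakTwistedModule g T) (S : set M) :
  is_regular g T omega -> is_ordinary omega M ->
  uniformly_truncated (fun w : {w : M | S w} => sval w) -> fd_bounded S.
Proof.
move=> reg [_ M_fd _] S_tr.
pose I := {w : M | S w}.
pose x : truncated_power M I := TruncatedPower (introT (asboolP _) S_tr).
pose U := power_module g_order M I.
have [J [N [f [N_ord f_hom U_sum]]]] := reg U.
pose L : {linear U -> U} := tm_mode U omega (0 + 1)%:~R.
have x_sum : sums [set z : U | exists a, eigenspace_of L a z] x.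
  have := direct_sum_sums (x : U) U_sum.
  apply: (sums_bind (f := idfun)) => // _ [j [y _ <-]].
  have [_ [Nj_sum _ _]] := N_ord j.
  have := direct_sum_sums y Nj_sum.
  apply: (sums_bind (f := f j)) => [|a b|z [a az]].
  - exact: linear0.
  - exact: linearD.
  - apply: sums_one; exists a; have [_ f_mod] := f_hom j.
    by rewrite /eigenspace_of /= /L -f_mod [tm_mode _ _ _ _]az linearZ.
suff /(_ x x_sum)[B xB Bfd] : forall z : U,
    sums [set z : U | exists a, eigenspace_of L a z] z ->
    fd_bounded [set w | exists i, w = coords z i].
  by exists B => // w Sw; apply: xB; exists (exist _ w Sw).
move=> z; elim=> [|{}z z' [a az] _ IH].
  exists (eigenspace_of (tm_vir (M := M) omega 0) 0); last exact: M_fd.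
  by move=> _ [i ->]; exact: (eigen0 (tm_mode M omega (0 + 1)%:~R)).
have z_fd : fd_bounded [set w | exists i, w = coords z i].
  exists (eigenspace_of (tm_vir (M := M) omega 0) a); last exact: M_fd.
  by move=> _ [i ->]; have := congr1 (fun y : truncated_power M I => coords y i) az.
have [B sB Bfd] := fd_boundedD z_fd IH; exists B => // _ [i ->]; apply: sB.
by exists (coords z i), (coords z' i); split; [exists i|exists i|].
Qed.

End Finiteness.

(** * Change of conformal vector *)

Section RealPart.
Variable R : realType.
Implicit Types x y : R[i].

Lemma ReD x y : complex.Re (x + y) = complex.Re x + complex.Re y.
Proof. by case: x y => ? ? []. Qed.

Lemma ReN x : complex.Re (- x) = - complex.Re x.
Proof. by case: x. Qed.

Lemma Re_rat (q : rat) : complex.Re (ratr q : R[i]) = ratr q.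
Proof. by rewrite -(fmorph_rat (real_complex R)). Qed.

Lemma Re_int (n : int) : complex.Re (n%:~R : R[i]) = n%:~R.
Proof. by rewrite -(rmorph_int (real_complex R)). Qed.

End RealPart.

Section ChangeOfConformalVector.
Variables (R : realType) (V : vertexAlgebra R) (omega omega' : V).
Variables (g : {linear V -> V}) (T : nat).
Hypothesis omega_voa : is_voa omega.
Hypothesis omega'_voa : is_voa omega'.
Hypothesis omega_aut : is_voa_automorphism omega g.
Hypothesis omega'_aut : is_voa_automorphism omega' g.
Hypothesis g_order : has_order g T.
Variable M : weakTwistedModule g T.
Hypothesis M_ordinary : is_ordinary omega M.

Definition weight_le (k : rat) : set V :=
  sums [set x | exists r a, [/\ (r < T)%N, homogeneous g T omega r a x & a%:~R <= k]].

(** v_n shifts weights by (weight of v) - n - 1, so the two conditions make it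
    lower both gradings strictly.  As L(0) and L'(0) need not commute, v is
    asked to be homogeneous for L'(0) only; for L(0) a bound on the weights of
    its components is enough. *)
Definition lowering (v : V) (n : rat) :=
  (exists r a, [/\ (r < T)%N, homogeneous g T omega' r a v & a%:~R <= n]) /\
  weight_le n v.

Fixpoint lowering_nilpotent (s : nat) (w : M) : Prop :=
  if s is s'.+1 then
    forall v n, lowering v n -> lowering_nilpotent s' (tm_mode M v n w)
  else w = 0.

Definition singular : set M :=
  [set w | forall v n, lowering v n -> tm_mode M v n w = 0].

Local Notation L := (tm_mode M omega (0 + 1)%:~R : {linear M -> M}).
Local Notation L' := (tm_mode M omega' (0 + 1)%:~R : {linear M -> M}).

Lemma weight_le_exists v : exists k, weight_le k v.
Proof.
have := homogeneous_decomposition v g_order omega_voa omega_aut.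
elim=> [|x y [r [a [rT xra]]] _ [k yk]]; first by exists 0; exact: sums_nil.
exists (Num.max k a%:~R); apply: sums_cons.
  by exists r, a; split=> //; rewrite le_max lexx orbT.
apply: (sums_bind (f := idfun)) yk => // z [r' [a' [r'T z' a'k]]].
by apply: sums_one; exists r', a'; split=> //; rewrite le_max a'k.
Qed.

Lemma weight_le_mono k l v : k <= l -> weight_le k v -> weight_le l v.
Proof.
move=> kl; apply: (sums_bind (f := idfun)) => // z [r [a [rT z' ak]]].
by apply: sums_one; exists r, a; split=> //; exact: le_trans kl.
Qed.

Lemma lowering_nilpotent0 s : lowering_nilpotent s 0.
Proof. by elim: s => //= s IH v n _; rewrite linear0. Qed.

Lemma lowering_nilpotentD s x y :
  lowering_nilpotent s x -> lowering_nilpotent s y -> lowering_nilpotent s (x + y).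
Proof.
elim: s x y => [|s IH] x y /= xs ys; first by rewrite xs ys addr0.
by move=> v n vn; rewrite linearD; apply: IH; [exact: xs | exact: ys].
Qed.

Lemma lowering_nilpotent_mono s t x : (s <= t)%N ->
  lowering_nilpotent s x -> lowering_nilpotent t x.
Proof.
elim: s t x => [|s IH] t x; first by move=> _ ->; exact: lowering_nilpotent0.
by case: t => // t st xs v n /xs; exact: IH.
Qed.

(** For a lowering mode v_n, each homogeneous component x of v sends an
    eigenvector to one whose weight is smaller by a positive multiple of 1/T;
    after s such steps the weight is one that does not occur. *)
Lemma eigen_lowering_nilpotent s mu w :
  (forall j, (s <= j)%N -> eigenspace_of L (mu - j%:R / T%:R) `<=` [set 0]) ->
  eigenspace_of L mu w -> lowering_nilpotent s w.
Proof.
elim: s mu w => [|s IH] mu w low muw /=.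
  by apply: (low 0%N) => //; rewrite mul0r subr0.
move=> v n [_]; elim=> [|x y [r [a [rT xa an]]] _ yn].
  by rewrite tm_mode0; exact: lowering_nilpotent0.
rewrite tm_modeD; apply: lowering_nilpotentD => //.
have [[p np]|notin] := pselect (exists p : int, n = r%:R / T%:R + p%:~R); last first.
  rewrite (tm_support _ rT (proj1 xa)) => [|p np]; first exact: lowering_nilpotent0.
  by apply: notin; exists p.
apply: IH (eigen_mode n rT omega_voa omega_aut xa muw) => j sj.
have T0 : (0 < T)%N by case: (T) rT.
have Tn0 : (T%:R : rat) != 0 by rewrite pnatr_eq0 -lt0n.
have Tc0 : (T%:R : R[i]) != 0 by rewrite pnatr_eq0 -lt0n.
(* x_n lowers the weight by d / T. *)
pose d : int := r%:Z + (p + 1 - a) * T%:Z.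
have dE : d%:~R = (n + 1 - a%:~R) * T%:R :> rat.
  by rewrite np /d intrD intrM intrB intrD -!pmulrn; field.
have d1 : 1 <= d.
  have : (0 : rat) < d%:~R.
    by rewrite dE mulr_gt0 ?ltr0n //; move: an; lra.
  by rewrite ltr0z.
have -> : mu + (a%:~R - ratr n - 1) - j%:R / T%:R = mu - (`|d|%N + j)%:R / T%:R.
  have -> : (`|d|%N + j)%:R = ratr ((n + 1 - a%:~R) * T%:R) + j%:R :> R[i].
    rewrite -dE natrD ratr_int; congr (_ + _).
    by rewrite -[in RHS](gez0_abs (_ : 0 <= d)) //; lia.
  have -> : ratr ((n + 1 - a%:~R) * T%:R) = (ratr n + 1 - a%:~R) * T%:R :> R[i].
    by rewrite rmorphM rmorphB rmorphD rmorph1 rmorph_int rmorph_nat.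
  by field.
by apply: low; lia.
Qed.

Lemma lowering_nilpotent_exists w : exists s, lowering_nilpotent s w.
Proof.
have [M_sum _ M_low] := M_ordinary.
have := direct_sum_sums w M_sum; elim=> [|x y [mu mux] _ [t yt]].
  by exists 0%N.
have [K muK] := M_low mu.
have [s xs] : exists s, lowering_nilpotent s x.
  exists `|K|%N; apply: (eigen_lowering_nilpotent (mu := mu)) => // j Kj z zj.
  have Kj' : - j%:Z <= K by lia.
  have jE : - j%:R = (- j%:Z)%:~R :> R[i] by rewrite mulrNz.
  rewrite -(muK _ Kj'); congr (eigenspace_of _ _ z): zj.
  by rewrite addrC -mulNr jE.
exists (maxn s t); apply: lowering_nilpotentD.
  by apply: lowering_nilpotent_mono xs; rewrite leq_maxl.
by apply: lowering_nilpotent_mono yt; rewrite leq_maxr.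
Qed.

(** Apply lowering modes as long as one of them does not kill the vector; the
    process stops by nilpotency, and along the way the real part of an
    L'(0)-weight can only decrease. *)
Lemma singular_exists w : w != 0 -> exists z, [/\ singular z, z != 0
  & forall mu, eigenspace_of L' mu w ->
      exists2 mu', eigenspace_of L' mu' z & complex.Re mu' <= complex.Re mu].
Proof.
have [s ws] := lowering_nilpotent_exists w.
elim: s w ws => [|s IH] w /= ws w0; first by rewrite ws eqxx in w0.
have [w_sing|] := pselect (singular w).
  by exists w; split=> // mu muw; exists mu.
move=> /existsNP[v /existsNP[n /not_implyP[vn /eqP vw0]]].
have [z [z_sing z0 zmu]] := IH _ (ws v n vn) vw0; exists z; split=> // mu muw.
have [[r [a [rT va an]]] _] := vn.
have [mu' mu'z le_mu'] := zmu _ (eigen_mode n rT omega'_voa omega'_aut va muw).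
exists mu' => //; apply: le_trans le_mu' _.
rewrite !ReD !ReN Re_rat Re_int [complex.Re 1]/=.
have : ratr a%:~R <= ratr n :> R by rewrite ler_rat.
by rewrite ratr_int; lra.
Qed.

Lemma singular_subspace : is_subspace singular.
Proof.
split=> [v n _|a x y x_sing y_sing v n vn]; first exact: linear0.
by rewrite linearP /= x_sing // y_sing // scaler0 addr0.
Qed.

(** L'(0) and v_n commute up to a multiple of v_n when v is homogeneous for
    L'(0). *)
Lemma singular_L0 x : singular x -> singular (L' x).
Proof.
move=> x_sing v n vn; have [[r [a [rT va an]]] _] := vn.
have := tm_L0_homogeneous n x rT omega'_voa omega'_aut va.
by rewrite /= x_sing // linear0 scaler0 addr0.
Qed.

Lemma singular_truncated : uniformly_truncated (fun w : {w : M | singular w} => sval w).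
Proof.
move=> u; have := homogeneous_decomposition u g_order omega'_voa omega'_aut.
apply: truncated_sums => {}u [r [a [rT ua]]]; have [k uk] := weight_le_exists u.
exists (Num.max a%:~R k) => n; rewrite ge_max => /andP[an kn] [w w_sing] /=.
by apply: w_sing; split; [exists r, a | exact: weight_le_mono uk].
Qed.

(** The weights of L'(0) on the finite-dimensional space of singular vectors
    control those on all of M. *)
Lemma ordinary_change : is_regular g T omega -> is_irreducible M ->
  is_ordinary omega' M.
Proof.
move=> reg [[w0 /eqP w0_neq0] M_irr].
have sing_fd := fd_bounded_subspace singular_subspace
  (truncated_set_fd g_order reg M_ordinary singular_truncated).
have [s s_sing] := roots_at_exists (f := L') sing_fd singular_L0.
have [B B_s] : exists B : R, forall a, a \in s -> B <= complex.Re a.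
  elim: s {s_sing} => [|a s [B Bs]]; first by exists 0.
  exists (Num.min B (complex.Re a)) => b; rewrite inE ge_min => /predU1P[->|/Bs->//].
  by rewrite lexx orbT.
have Re_ge mu w : eigenspace_of L' mu w -> w != 0 -> B <= complex.Re mu.
  move=> muw w_neq0; have [z [z_sing z0 /(_ _ muw)[mu' mu'z]]] := singular_exists w_neq0.
  by apply: le_trans; apply: B_s; exact: roots_at_eigen mu'z z0 (s_sing _ z_sing).
have [z0 [z0_sing z0_neq0 _]] := singular_exists w0_neq0.
have [mu [z [_ z_neq0 muz]]] := roots_at_eigenvector singular_subspace singular_L0
  z0_sing z0_neq0 (s_sing _ z0_sing).
pose E := [set w | sums [set x | exists a, eigenspace_of L' a x] w].
(* Modes of homogeneous vectors map eigenvectors of L'(0) to eigenvectors. *)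
have E_sub : is_submodule E.
  split; first split; first exact: sums_nil.
    move=> a x y xE yE; apply: sumsD => //.
    apply: (sums_bind (f := fun x => a *: x)) xE => [|b c|x' [b bx]].
    - exact: scaler0.
    - exact: scalerDr.
    - by apply: sums_one; exists b; exact: (eigenZ (f := L')).
  move=> u n; apply: (sums_bind (f := tm_mode M u n)) => [|b c|x [b bx]].
  - exact: linear0.
  - exact: linearD.
  - apply: (sums_bind (f := fun u => tm_mode M u n x))
      (homogeneous_decomposition u g_order omega'_voa omega'_aut).
    + exact: tm_mode0.
    + by move=> v v'; exact: tm_modeD.
    + move=> v [r [a [rT va]]]; apply: sums_one.
      by exists (b + (a%:~R - ratr n - 1));
        exact: (eigen_mode n rT omega'_voa omega'_aut va bx).
have E_full w : E w.
  have [E0|->//] := M_irr E E_sub.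
  have : E z by apply: sums_one; exists mu.
  by rewrite E0 => /= z_eq0; rewrite z_eq0 eqxx in z_neq0.
split.
- exact: (eigen_direct_sum (f := L')).
- move=> a; apply: (fd_bounded_subspace (eigen_subspace L' a)).
  apply: (truncated_set_fd g_order reg M_ordinary) => u.
  have := homogeneous_decomposition u g_order omega'_voa omega'_aut.
  apply: truncated_sums => {}u [r [b [rT ub]]].
  (* Beyond this index u_n lands in a weight with real part below B. *)
  exists (Num.ceil (complex.Re a + b%:~R - B))%:~R => n Kn [w aw] /=.
  apply/eqP/negPn/negP => uw0.
  have := Re_ge _ _ (eigen_mode n rT omega'_voa omega'_aut ub aw) uw0.
  rewrite !ReD !ReN Re_rat Re_int [complex.Re 1]/=.
  have : ratr (Num.ceil (complex.Re a + b%:~R - B))%:~R <= ratr n :> R by rewrite ler_rat.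
  rewrite ratr_int; have := ceil_ge (complex.Re a + b%:~R - B); lra.
- move=> a; have T0 : (0 < T)%N by have [] := g_order.
  (* The real part of n / T + a must stay below B. *)
  exists (Num.floor ((B - complex.Re a) * T%:R) - 1) => n nN.
  apply/seteqP; split=> [w aw|_ ->]; last exact: (eigen0 L').
  apply/eqP/negPn/negP => w0n; have := Re_ge _ _ aw w0n.
  have -> : n%:~R / T%:R + a = ratr (n%:~R / T%:R) + a.
    by rewrite fmorph_div rmorph_int rmorph_nat.
  rewrite ReD Re_rat fmorph_div rmorph_int rmorph_nat leNgt => /negP; apply.
  rewrite -ltrBrDr ltr_pdivrMr ?ltr0n //.
  apply: lt_le_trans (floor_le _); rewrite ltr_int; move: (Num.floor _) nN => c; lia.
Qed.

End ChangeOfConformalVector.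

Lemma regular_change (R : realType) (V : vertexAlgebra R) (omega omega' : V)
    (g : {linear V -> V}) (T : nat) :
  is_voa omega -> is_voa omega' ->
  is_voa_automorphism omega g -> is_voa_automorphism omega' g ->
  has_order g T -> is_regular g T omega -> is_regular g T omega'.
Proof.
move=> voa voa' aut aut' g_order reg M.
have [I [N [f [N_ord f_hom M_sum]]]] := reg M.
exists I, N, f; split=> // i; have [irr ord] := N_ord i; split=> //.
exact: (ordinary_change voa voa' aut aut').
Qed.

Theorem theorem4p5 (R : realType) (V : vertexAlgebra R) (omega omega' : V)
    (voa_omega : is_voa omega) (voa_omega' : is_voa omega')
    (g : {linear V -> V}) (T : nat)
    (aut_g : is_voa_automorphism omega g)
    (aut_g' : is_voa_automorphism omega' g)
    (order_g : has_order g T) :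
  is_regular g T omega <-> is_regular g T omega'.
Proof. by split; apply: regular_change. Qed.
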